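(* For all integers $m>n\ge 1$, we have $d_{\mathrm{GH}}(B^m,B^n)<1$.
   Context: $B^n=\{x\in\mathbb{R}^n : x_1^2+\cdots+x_n^2\le 1\}$ is the closed unit ball, regarded as a metric space with the Euclidean metric. The Gromov--Hausdorff distance $d_{\mathrm{GH}}(X,Y)$ between metric spaces $X,Y$ is the infimum, over all metric spaces $Z$ and isometric embeddings $\phi\colon X\to Z$, $\psi\colon Y\to Z$, of the Hausdorff distance in $Z$ between $\phi(X)$ and $\psi(Y)$. Equivalently, $d_{\mathrm{GH}}(X,Y)=\frac12\inf_C \sup_{(x,y),(x',y')\in C}|d_X(x,x')-d_Y(y,y')|$, where $C$ ranges over all correspondences, i.e. relations $C\subseteq X\times Y$ whose projections to $X$ and to $Y$ are both surjective. *)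

(* Defs.v *)
From HB Require Import structures.
From mathcomp Require Import all_boot all_order all_algebra.
From mathcomp Require Import all_classical all_reals all_analysis.
From mathcomp Require Import ring.

Set Implicit Arguments.
Unset Strict Implicit.
Unset Printing Implicit Defensive.

Import Order.TTheory GRing.Theory Num.Theory.

Local Open Scope classical_set_scope.
Local Open Scope ring_scope.

(* ['rV[R]_n] already carries the sup-norm topology, so the Euclidean metric
   lives on an alias of it. *)
Definition euclid (R : realType) (n : nat) : Type := 'rV[R]_n.

HB.instance Definition _ (R : realType) (n : nat) :=
  Choice.copy (euclid R n) 'rV[R]_n.

Definition euclid_dist (R : realType) (n : nat) (x y : euclid R n) : R :=
  Num.sqrt (\sum_i (x 0 i - y 0 i) ^+ 2).

Section EuclidMetric.
Variables (R : realType) (n : nat).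
Implicit Types x y z : euclid R n.

Lemma sum_sqr_ge0 (a : 'I_n -> R) : 0 <= \sum_i a i ^+ 2.
Proof. by apply: sumr_ge0 => i _; exact: sqr_ge0. Qed.

Lemma sum_cauchy_schwarz (a b : 'I_n -> R) :
  (\sum_i a i * b i) ^+ 2 <= (\sum_i a i ^+ 2) * (\sum_i b i ^+ 2).
Proof.
have : 0 <= \sum_i \sum_j (a i * b j - a j * b i) ^+ 2.
  by apply: sumr_ge0 => i _; apply: sumr_ge0 => j _; exact: sqr_ge0.
have -> : \sum_i \sum_j (a i * b j - a j * b i) ^+ 2 =
    ((\sum_i a i ^+ 2) * (\sum_i b i ^+ 2) - (\sum_i a i * b i) ^+ 2) *+ 2.
  have inner i : \sum_j (a i * b j - a j * b i) ^+ 2 =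
      a i ^+ 2 * (\sum_j b j ^+ 2) + b i ^+ 2 * (\sum_j a j ^+ 2)
      - (a i * b i * (\sum_j a j * b j)) *+ 2.
    rewrite !mulr_sumr -sumrMnl -big_split -sumrB/=.
    by apply: eq_bigr => j _; ring.
  under eq_bigr do rewrite inner.
  by rewrite sumrB big_split/= sumrMnl -!mulr_suml; ring.
by rewrite pmulrn_lge0// subr_ge0.
Qed.

Lemma euclid_distxx x : euclid_dist x x = 0.
Proof.
by rewrite /euclid_dist big1 ?sqrtr0// => i _; rewrite subrr expr0n.
Qed.

Lemma euclid_dist_eq0 x y : euclid_dist x y = 0 -> x = y.
Proof.
move/eqP; rewrite sqrtr_eq0 => le0.
have /eqP : \sum_i (x 0 i - y 0 i) ^+ 2 = 0.
  by apply/le_anti; rewrite le0 sum_sqr_ge0.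
rewrite psumr_eq0 => [/allP e|i _]; last exact: sqr_ge0.
apply/rowP => i; apply/eqP; rewrite -subr_eq0 -sqrf_eq0.
exact: (e i (mem_index_enum _)).
Qed.

Lemma euclid_dist_sym x y : euclid_dist x y = euclid_dist y x.
Proof.
by congr Num.sqrt; apply: eq_bigr => i _; rewrite -sqrrN opprB.
Qed.

Lemma euclid_dist_triangle y x z :
  euclid_dist x z <= euclid_dist x y + euclid_dist y z.
Proof.
rewrite /euclid_dist.
set a := fun i => x 0 i - y 0 i; set b := fun i => y 0 i - z 0 i.
have -> : \sum_i (x 0 i - z 0 i) ^+ 2 =
    \sum_i a i ^+ 2 + \sum_i b i ^+ 2 + (\sum_i a i * b i) *+ 2.
  rewrite -sumrMnl -!big_split/=; apply: eq_bigr => i _.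
  rewrite /a /b; ring.
rewrite -[leRHS]ger0_norm ?addr_ge0 ?sqrtr_ge0// -sqrtr_sqr ler_sqrt ?sqr_ge0//.
rewrite sqrrD !sqr_sqrtr ?sum_sqr_ge0// addrAC lerD2r lerD2l ler_wMn2r//.
rewrite -sqrtrM ?sum_sqr_ge0// (le_trans (ler_norm _))// -sqrtr_sqr.
by rewrite ler_wsqrtr// sum_cauchy_schwarz.
Qed.

End EuclidMetric.

HB.instance Definition _ (R : realType) (n : nat) :=
  isMetric.Build R (euclid R n) (@euclid_distxx R n) (@euclid_dist_eq0 R n)
    (@euclid_dist_sym R n) (@euclid_dist_triangle R n).

Section SubspaceMetric.
Variables (R : realType) (X : metricType R) (A : set X).

Let sub_dist (x y : A) : R := mdist (set_val x) (set_val y).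

Let sub_dist_ge0 x y : 0 <= sub_dist x y.
Proof. exact: mdist_ge0. Qed.

Let sub_dist_positivity x y : sub_dist x y = 0 -> x = y.
Proof. by move=> /mdist_positivity /val_inj. Qed.

Let sub_ballE (x : A) d : ball x d = [set y | sub_dist x y < d].
Proof.
transitivity ((set_val : A -> X) @^-1` ball (set_val x) d); first by [].
by rewrite ballEmdist.
Qed.

HB.instance Definition _ := PseudoMetric_isMetric.Build R A
  sub_dist_ge0 sub_dist_positivity sub_ballE.

End SubspaceMetric.

Definition unit_ball (R : realType) (n : nat) : set (euclid R n) :=
  [set x | \sum_i x 0 i ^+ 2 <= 1].
Arguments unit_ball : clear implicits.

Lemma mdist_unit_ballE (R : realType) (n : nat) (x y : unit_ball R n) :
  mdist x y = Num.sqrt (\sum_i ((\val x) 0 i - (\val y) 0 i) ^+ 2).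
Proof. by []. Qed.

Definition isometric_embedding (R : realType) (X Z : metricType R)
  (f : X -> Z) : Prop := forall x x', mdist (f x) (f x') = mdist x x'.

(* The infimum, in [0, +oo], of the radii of open neighbourhoods of each set
   that cover the other one. *)
Definition hausdorff_dist (R : realType) (Z : metricType R) (A B : set Z) :
    \bar R :=
  ereal_inf [set r%:E | r in [set r : R | [/\ 0 < r,
    A `<=` \bigcup_(b in B) ball b r & B `<=` \bigcup_(a in A) ball a r]]].

Definition gromov_hausdorff_dist (R : realType) (X Y : metricType R) : \bar R :=
  ereal_inf [set d : \bar R | exists (Z : metricType R) (f : X -> Z) (g : Y -> Z),
    [/\ isometric_embedding f, isometric_embedding g &
        d = hausdorff_dist (range f) (range g)]].
Arguments gromov_hausdorff_dist {R} X Y.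

(* Main.v *)
Require Import Defs.
From HB Require Import structures.
From mathcomp Require Import all_boot all_order all_algebra.
From mathcomp Require Import all_classical all_reals all_analysis.
From mathcomp Require Import lra.

Set Implicit Arguments.
Unset Strict Implicit.
Unset Printing Implicit Defensive.

Import Order.TTheory GRing.Theory Num.Theory.

Local Open Scope classical_set_scope.
Local Open Scope ring_scope.

(** Two balls of diameter 2 are always within Gromov-Hausdorff distance 1; to
    do better it suffices to find a correspondence whose distortion is bounded
    away from 2.  Since all distances lie in [0, 2], this only requires that
    nearly antipodal points are never matched with nearly equal points, nor
    nearly equal points with nearly antipodal ones; no continuity is involved.

    Write m = n + k.  Points x of B^n of norm at least 1/2 are matched with
    their image [pad k x] under the inclusion in B^m.  Two points of B^n at
    distance more than 3/2 both have norm above 1/2, so their distance is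
    preserved exactly ([shell_rel_shrink]).  The rest of B^n is used to reach
    all of B^m: cut B^m into its 2^m orthants, choose for each orthant a sphere
    in B^n centred at the origin, the radii being spaced by a gap delta and at
    most 1/2 - delta, and match every point of the sphere with every point of
    the orthant.  Finally all x of norm at most 1/2 are matched with the centre
    of B^m, which only ensures that no point of B^n is left out.

    If x and x' are closer than delta ([shell_rel_expand_near]), then their
    norms differ by less than delta, so they cannot lie on spheres of different
    orthants, nor one on such a sphere and the other in the outer shell.  Hence
    their partners either are at the same distance as x and x', or include the
    centre (distance at most 1), or share an orthant (distance at most
    sqrt 2 because their scalar product is nonnegative).  The distortion is
    therefore at most 2 - delta, and [gromov_hausdorff_dist_le_distortion]
    bounds the Gromov-Hausdorff distance by 1 - delta / 2. *)

(** * Correspondences bound the Gromov-Hausdorff distance *)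

Section Gluing.
Variables (R : realType) (X Y : metricType R) (C : X -> Y -> Prop) (rho : R).
Hypothesis rho_gt0 : 0 < rho.
Hypothesis C_left_total : forall x, exists y, C x y.
Hypothesis C_right_total : forall y, exists x, C x y.
Hypothesis C_distortion : forall x y x' y', C x y -> C x' y' ->
  `|mdist x x' - mdist y y'| <= rho *+ 2.

(** The metrics of X and Y are extended to the disjoint union by letting every
    pair related by C be joined by a segment of length rho; [bridge x y] is the
    length of the shortest path from x to y crossing one such segment. *)
Let bridges (x : X) (y : Y) : set R :=
  [set d | exists a b, C a b /\ d = mdist x a + rho + mdist b y].

Let bridge (x : X) (y : Y) : R := inf (bridges x y).

Let bridge_le x y a b : C a b -> bridge x y <= mdist x a + rho + mdist b y.
Proof.
move=> Cab; apply: ge_inf; last by exists a, b.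
exists 0 => _ [a' [b' [_ ->]]].
by rewrite !addr_ge0 ?mdist_ge0// ltW.
Qed.

Let le_bridge x y t :
  (forall a b, C a b -> t <= mdist x a + rho + mdist b y) -> t <= bridge x y.
Proof.
move=> le_t; apply: lb_le_inf => [|_ [a [b [Cab ->]]]]; last exact: le_t.
by have [b Cxb] := C_left_total x; exists (mdist x x + rho + mdist b y), x, b.
Qed.

Let bridge_ge x y : rho <= bridge x y.
Proof.
apply: le_bridge => a b _.
by have := mdist_ge0 x a; have := mdist_ge0 b y; lra.
Qed.

Let bridge_C x y : C x y -> bridge x y <= rho.
Proof. by move=> /(bridge_le x y); rewrite !mdistxx add0r addr0. Qed.

Let bridge_lipl x x' y : bridge x y <= mdist x x' + bridge x' y.
Proof.
rewrite -lerBlDl; apply: le_bridge => a b /(bridge_le x y).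
by have := metric_triangle x x' a; lra.
Qed.

Let bridge_lipr x y y' : bridge x y <= bridge x y' + mdist y' y.
Proof.
rewrite -lerBlDr; apply: le_bridge => a b /(bridge_le x y).
by have := metric_triangle b y' y; lra.
Qed.

(** The distortion hypothesis says precisely that going from X to Y and back
    along two bridges, of total length 2 rho, is no shortcut. *)
Let le_bridge2l x x' y : mdist x x' <= bridge x y + bridge x' y.
Proof.
rewrite -lerBlDr; apply: le_bridge => a b Cab.
rewrite lerBlDr -lerBlDl; apply: le_bridge => a' b' Cab'.
have := C_distortion Cab Cab'; rewrite ler_norml => /andP[_].
have := metric_triangle x a x'; have := metric_triangle a a' x'.
have := metric_triangle b y b'; rewrite (metric_sym a' x') (metric_sym y b').
by rewrite mulr2n; lra.
Qed.

Let le_bridge2r x y y' : mdist y y' <= bridge x y + bridge x y'.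
Proof.
rewrite -lerBlDr; apply: le_bridge => a b Cab.
rewrite lerBlDr -lerBlDl; apply: le_bridge => a' b' Cab'.
have := C_distortion Cab Cab'; rewrite ler_norml => /andP[+ _].
have := metric_triangle y b y'; have := metric_triangle b b' y'.
have := metric_triangle a x a'; rewrite (metric_sym a x) (metric_sym y b).
by rewrite mulr2n; lra.
Qed.

Let glue_dist (u v : X + Y) : R :=
  match u, v with
  | inl x, inl x' => mdist x x'
  | inr y, inr y' => mdist y y'
  | inl x, inr y | inr y, inl x => bridge x y
  end.

Let glue_distxx u : glue_dist u u = 0.
Proof. by case: u => z /=; rewrite mdistxx. Qed.

Let glue_dist_eq0 u v : glue_dist u v = 0 -> u = v.
Proof.
case: u v => [x|y] [x'|y'] /=.
- by move/mdist_positivity ->.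
- by move=> xy0; have := bridge_ge x y'; rewrite xy0 leNgt rho_gt0.
- by move=> xy0; have := bridge_ge x' y; rewrite xy0 leNgt rho_gt0.
- by move/mdist_positivity ->.
Qed.

Let glue_dist_sym u v : glue_dist u v = glue_dist v u.
Proof. by case: u v => [x|y] [x'|y'] //=; exact: metric_sym. Qed.

Let glue_dist_triangle v u w :
  glue_dist u w <= glue_dist u v + glue_dist v w.
Proof.
case: u v w => [x|y] [x'|y'] [x''|y''] /=.
- exact: metric_triangle.
- exact: bridge_lipl.
- exact: le_bridge2l.
- exact: bridge_lipr.
- by rewrite addrC (metric_sym x'); exact: bridge_lipl.
- exact: le_bridge2r.
- by rewrite addrC (metric_sym y); exact: bridge_lipr.
- exact: metric_triangle.
Qed.

Definition glued : Type := (X + Y)%type.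

HB.instance Definition _ := Choice.copy glued (X + Y)%type.

HB.instance Definition _ := isMetric.Build R glued
  glue_distxx glue_dist_eq0 glue_dist_sym glue_dist_triangle.

(** In the glued space related points are at distance rho, so X and Y are within
    Hausdorff distance rho of each other. *)
Lemma gromov_hausdorff_dist_le_distortion :
  (gromov_hausdorff_dist X Y <= rho%:E)%E.
Proof.
apply/lee_addgt0Pr => e e_gt0.
have near x y : C x y -> bridge x y < rho + e.
  by move=> /bridge_C; lra.
apply: ge_ereal_inf.
exists (hausdorff_dist (range (inl : X -> glued)) (range (inr : Y -> glued))).
  by exists glued, inl, inr; split.
apply: ge_ereal_inf; exists (rho + e)%:E; last by rewrite EFinD.
exists (rho + e) => //; split; first by rewrite addr_gt0.
- move=> _ [x _ <-]; have [y Cxy] := C_left_total x.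
  by exists (inr y); [exists y | rewrite ballEmdist; exact: near].
- move=> _ [y _ <-]; have [x Cxy] := C_right_total y.
  by exists (inl x); [exists x | rewrite ballEmdist; exact: near].
Qed.

End Gluing.

(** * Padding and orthants in Euclidean space *)

Section Euclid.
Variable R : realType.
Implicit Types n k : nat.

Definition euclid_norm n (x : euclid R n) : R :=
  euclid_dist x (0 : 'rV[R]_n).

Lemma euclid_normE n (x : euclid R n) :
  euclid_norm x = Num.sqrt (\sum_i x 0 i ^+ 2).
Proof. by congr Num.sqrt; apply: eq_bigr => i _; rewrite mxE subr0. Qed.

Lemma sqr_euclid_norm n (x : euclid R n) :
  euclid_norm x ^+ 2 = \sum_i x 0 i ^+ 2.
Proof. by rewrite euclid_normE sqr_sqrtr ?sum_sqr_ge0. Qed.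

Lemma unit_ballE n (x : euclid R n) : unit_ball R n x = (euclid_norm x <= 1).
Proof.
by rewrite /unit_ball/= -sqr_euclid_norm expr_le1 ?sqrtr_ge0.
Qed.

Lemma euclid_dist_le_normD n (x y : euclid R n) :
  euclid_dist x y <= euclid_norm x + euclid_norm y.
Proof.
by rewrite /euclid_norm (euclid_dist_sym y); exact: euclid_dist_triangle.
Qed.

Lemma euclid_norm_lip n (x y : euclid R n) :
  euclid_norm x <= euclid_norm y + euclid_dist x y.
Proof. by rewrite addrC; exact: euclid_dist_triangle. Qed.

Definition pad n k (x : euclid R n) : euclid R (n + k) :=
  row_mx (x : 'rV[R]_n) (0 : 'rV[R]_k).

Lemma pad_dist n k (x y : euclid R n) :
  euclid_dist (pad k x) (pad k y) = euclid_dist x y.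
Proof.
congr Num.sqrt; rewrite big_split_ord/= [X in _ + X]big1 ?addr0.
  by apply: eq_bigr => i _; rewrite !row_mxEl.
by move=> i _; rewrite !row_mxEr !mxE subrr expr0n.
Qed.

Lemma pad_norm n k (x : euclid R n) : euclid_norm (pad k x) = euclid_norm x.
Proof.
have pad0 : pad k (0 : 'rV[R]_n) = (0 : 'rV[R]_(n + k)) by exact: row_mx0.
by rewrite {1}/euclid_norm -pad0 pad_dist.
Qed.

Lemma euclid_norm_surj n (r : R) : 0 <= r ->
  exists x : euclid R n.+1, euclid_norm x = r.
Proof.
move=> r_ge0; exists (\row_i if i == ord0 then r else 0).
rewrite euclid_normE (bigD1 ord0)//= big1 ?addr0.
  by rewrite mxE eqxx sqrtr_sqr ger0_norm.
by move=> i /negbTE ne_i0; rewrite mxE ne_i0 expr0n.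
Qed.

(** Zero counts as positive, so that the orthants partition the space. *)
Definition orthant n (x : euclid R n) : {set 'I_n} := [set i | 0 <= x 0 i].

(** Points of a common orthant form an angle of at most 90 degrees. *)
Lemma orthant_dist_sqr n (x y : euclid R n) : orthant x = orthant y ->
  euclid_dist x y ^+ 2 <= euclid_norm x ^+ 2 + euclid_norm y ^+ 2.
Proof.
move=> eq_xy; rewrite !sqr_euclid_norm sqr_sqrtr ?sum_sqr_ge0//.
rewrite -big_split/=; apply: ler_sum => i _.
have : (0 <= x 0 i) = (0 <= y 0 i).
  by move/setP/(_ i): eq_xy; rewrite !inE.
case: (lerP 0 (x 0 i)) => xi; case: (lerP 0 (y 0 i)) => yi // _; nra.
Qed.

(** * A correspondence between balls of different dimensions *)

Section Shells.
Variables n k : nat.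
Implicit Types (x : euclid R n) (y : euclid R (n + k)).

(** With N orthants and delta = 1 / (2 (N + 1)), the radii delta, ..., N delta
    are delta apart and stay delta below 1/2 = (N + 1) delta. *)
Definition shell_gap : R := (2 * (#|{set 'I_(n + k)}|.+1)%:R)^-1.

Definition shell_radius y : R :=
  (enum_rank (orthant y)).+1%:R * shell_gap.

Definition shell_rel y x : Prop :=
  [\/ 2^-1 <= euclid_norm x /\ y = pad k x,
      euclid_norm x <= 2^-1 /\ y = (0 : 'rV[R]_(n + k)) |
      euclid_norm x = shell_radius y].

Lemma shell_gap_gt0 : 0 < shell_gap.
Proof. by rewrite invr_gt0 mulr_gt0. Qed.

Lemma shell_gap_le : shell_gap <= 2^-1.
Proof.
by rewrite lef_pV2 ?posrE ?mulr_gt0// ler_peMr// ler1n.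
Qed.

Lemma shell_radiusD_gap y :
  shell_radius y + shell_gap = (enum_rank (orthant y)).+2%:R * shell_gap.
Proof. by rewrite -[_.+2%:R]natr1 mulrDl mul1r. Qed.

Lemma shell_radius_le y : shell_radius y <= 2^-1 - shell_gap.
Proof.
rewrite lerBrDr shell_radiusD_gap /shell_gap invfM mulrCA ler_piMr ?invr_ge0//.
by rewrite ler_pdivrMr ?mul1r ?ler_nat// !ltnS ltn_ord.
Qed.

Lemma shell_radius_inj y y' :
  shell_radius y < shell_radius y' + shell_gap ->
  shell_radius y' < shell_radius y + shell_gap -> orthant y = orthant y'.
Proof.
rewrite !shell_radiusD_gap /shell_radius !ltr_pM2r ?shell_gap_gt0//.
rewrite !ltr_nat !ltnS => le_yy' le_y'y.
by apply: enum_rank_inj; apply/val_inj/eqP; rewrite eqn_leq le_yy'.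
Qed.

Lemma shell_rel_inner y x : shell_rel y x ->
  y = pad k x \/ euclid_norm x <= 2^-1.
Proof.
case=> [[_ ->]|[x_le _]| ->]; [by left|by right|right].
by have := shell_radius_le y; have := shell_gap_gt0; lra.
Qed.

(** Only points of norm at most 1/2 can be moved, and these are within 3/2 of
    every point of the ball. *)
Lemma shell_rel_shrink y x y' x' : shell_rel y x -> shell_rel y' x' ->
  euclid_norm x <= 1 -> euclid_norm x' <= 1 ->
  euclid_dist x x' <= euclid_dist y y' + (2 - shell_gap).
Proof.
move=> /shell_rel_inner yx /shell_rel_inner yx' x_le1 x'_le1.
have := euclid_dist_le_normD x x'; have := shell_gap_le.
have : 0 <= euclid_dist y y' by exact: sqrtr_ge0.
case: yx yx' => [->|?] [->|?]; rewrite ?pad_dist; lra.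
Qed.

(** The case analysis on the kinds of the two pairs: an orthant sphere is at
    least one gap away from the other spheres and from the outer shell, so close
    points of B^n can only be sent far apart through the centre of B^m or inside
    one orthant, where distances are at most 1 and sqrt 2. *)
Lemma shell_rel_expand_near y x y' x' : shell_rel y x -> shell_rel y' x' ->
  euclid_norm y <= 1 -> euclid_norm y' <= 1 ->
  euclid_dist x x' < shell_gap -> euclid_dist y y' <= 2 - shell_gap.
Proof.
move=> yx yx' y_le1 y'_le1 xx'.
have gap_le := shell_gap_le; have gap_gt0 := shell_gap_gt0.
have norm0 : euclid_norm (0 : 'rV[R]_(n + k)) = 0 by exact: euclid_distxx.
have yy' := euclid_dist_le_normD y y'.
have xlip := euclid_norm_lip x x'.
have x'lip := euclid_norm_lip x' x; rewrite euclid_dist_sym in x'lip.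
have r_le := shell_radius_le y; have r'_le := shell_radius_le y'.
case: yx => [[x_ge y_pad]|[_ y0]|xr]; last 2 first.
- by rewrite y0 norm0 in yy' *; lra.
- case: yx' => [[x'_ge _]|[_ y'0]|x'r]; first lra.
    by rewrite y'0 norm0 in yy' *; lra.
  (* Distance at most sqrt 2 < 3/2 <= 2 - shell_gap. *)
  have eq_yy' : orthant y = orthant y' by apply: shell_radius_inj; lra.
  have := orthant_dist_sqr eq_yy'.
  have : 0 <= euclid_norm y by exact: sqrtr_ge0.
  have : 0 <= euclid_norm y' by exact: sqrtr_ge0.
  by nra.
- case: yx' => [[x'_ge y'_pad]|[_ y'0]|x'r]; last lra.
    by rewrite y_pad y'_pad pad_dist; lra.
  by rewrite y'0 norm0 in yy' *; lra.
Qed.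

Lemma shell_rel_distortion y x y' x' : shell_rel y x -> shell_rel y' x' ->
  euclid_norm x <= 1 -> euclid_norm x' <= 1 ->
  euclid_norm y <= 1 -> euclid_norm y' <= 1 ->
  `|euclid_dist y y' - euclid_dist x x'| <= 2 - shell_gap.
Proof.
move=> yx yx' x_le1 x'_le1 y_le1 y'_le1; rewrite ler_norml; apply/andP; split.
  by have := shell_rel_shrink yx yx' x_le1 x'_le1; lra.
have : 0 <= euclid_dist x x' by exact: sqrtr_ge0.
have [|] := ltP (euclid_dist x x') shell_gap.
  by move/(shell_rel_expand_near yx yx' y_le1 y'_le1); lra.
by have := euclid_dist_le_normD y y'; lra.
Qed.

End Shells.
End Euclid.

Theorem theorem4 (R : realType) (m n : nat) (n_ge1 : (1 <= n)%N)
    (n_lt_m : (n < m)%N) :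
  (gromov_hausdorff_dist (unit_ball R m) (unit_ball R n) < 1%:E)%E.
Proof.
rewrite -(subnKC (ltnW n_lt_m)); move: (m - n)%N => k {m n_lt_m}.
(* In dimension at least 1 every radius in [0, 1] is the norm of some point,
   which is what lets each orthant sphere be nonempty. *)
case: n n_ge1 => // n _.
have gap_gt0 := shell_gap_gt0 R n.+1 k; have gap_le := shell_gap_le R n.+1 k.
have norm_le1 d (z : unit_ball R d) : euclid_norm (\val z) <= 1.
  by rewrite -unit_ballE; exact: set_valP.
pose C (y : unit_ball R (n.+1 + k)) (x : unit_ball R n.+1) :=
  shell_rel (\val y) (\val x).
apply: (@le_lt_trans _ _ (1 - shell_gap R n.+1 k / 2)%:E); last first.
  by rewrite lte_fin; lra.
apply: (@gromov_hausdorff_dist_le_distortion _ _ _ C); first lra.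
- move=> y.
  have r_ge0 : 0 <= shell_radius (\val y) by rewrite mulr_ge0 ?ltW.
  have [x xr] := euclid_norm_surj n r_ge0.
  have x_in : unit_ball R n.+1 x.
    by rewrite unit_ballE xr; have := shell_radius_le (\val y); lra.
  by exists (SigSub (mem_set x_in)); apply: Or33.
- move=> x; have [x_ge|x_le] := lerP 2^-1 (euclid_norm (\val x)).
    have y_in : unit_ball R (n.+1 + k) (pad k (\val x)).
      by rewrite unit_ballE pad_norm.
    by exists (SigSub (mem_set y_in)); apply: Or31.
  have y_in : unit_ball R (n.+1 + k) (0 : 'rV[R]_(n.+1 + k)).
    by rewrite unit_ballE /euclid_norm euclid_distxx ler01.
  by exists (SigSub (mem_set y_in)); apply: Or32; split => //; exact: ltW.
move=> y x y' x' yx yx'.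
have -> : (1 - shell_gap R n.+1 k / 2) *+ 2 = 2 - shell_gap R n.+1 k.
  by rewrite mulr2n; lra.
exact: (shell_rel_distortion yx yx' (norm_le1 _ _) (norm_le1 _ _)
  (norm_le1 _ _) (norm_le1 _ _)).
Qed.
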